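(* For all integers $m,n\ge 0$, $$|\mathcal{D}^*(m,n)|=|\mathcal{C}^*(m,n)|,$$ and consequently $$|\mathcal{D}^*(m,n)|=|\mathcal{D}(m,n-2m)|.$$
   Context: A Schur partition is a partition of an integer into positive parts such that any two consecutive parts (in sorted order) differ by at least $3$, and no two consecutive parts differing by exactly $3$ are both multiples of $3$. For a partition $\pi$, let $m(\pi)$ denote the number of parts of $\pi$ plus the number of even parts of $\pi$. $\mathcal{D}(m,n)$ is the set of Schur partitions $\pi$ of $n$ with $m(\pi)=m$; $\mathcal{D}^*(m,n)$ is the subset of $\mathcal{D}(m,n)$ in which every odd part is $\ge 3$ and every even part is $\ge 6$. $\mathcal{C}(m,n)$ is the set of partitions of $n$ into exactly $m$ odd parts, each part occurring at most twice; $\mathcal{C}^*(m,n)$ is the subset of $\mathcal{C}(m,n)$ in which every part is $>1$. Sets with negative $n$ are empty. *)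

(* Defs.v *)
From HB Require Import structures.
From mathcomp Require Import all_boot all_order all_algebra.

Set Implicit Arguments.
Unset Strict Implicit.
Unset Printing Implicit Defensive.

(* A partition is the sequence of its parts in weakly decreasing order.
   The total is an [int], so that a negative integer has no partition. *)
Definition is_intpart (n : int) (s : seq nat) : bool :=
  [&& sorted geq s, all (leq 1) s & Posz (sumn s) == n].

Record intpart (n : int) := IntPart { parts :> seq nat; _ : is_intpart n parts }.

HB.instance Definition _ (n : int) := [isSub for @parts n].
HB.instance Definition _ (n : int) := [Countable of intpart n by <:].

(* [intpart n] is finite: a partition of n has at most n parts, all at most n. *)
Definition intpart_code (n : int) (p : intpart n) :
    {bseq (absz n) of 'I_(absz n).+1} :=
  insub_bseq (absz n) [seq inord i | i <- p].

Definition intpart_decode (n : int)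
    (t : {bseq (absz n) of 'I_(absz n).+1}) : option (intpart n) :=
  insub [seq val i | i <- t].

Lemma leq_size_sumn (s : seq nat) : all (leq 1) s -> size s <= sumn s.
Proof.
elim: s => //= a s IHs /andP[a_gt0 /IHs le_s].
by rewrite -add1n leq_add.
Qed.

Lemma leq_mem_sumn (s : seq nat) (a : nat) : a \in s -> a <= sumn s.
Proof.
elim: s => //= b s IHs; rewrite inE => /orP[/eqP->|/IHs le_a].
  exact: leq_addr.
exact: leq_trans le_a (leq_addl _ _).
Qed.

Lemma intpart_codeK (n : int) : pcancel (@intpart_code n) (@intpart_decode n).
Proof.
move=> p; rewrite /intpart_decode /intpart_code.
have /and3P[_ p_gt0 /eqP sum_p] := valP p.
have sum_pE : sumn (val p) = absz n by exact: (f_equal absz sum_p).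
rewrite /insub_bseq val_insubd size_map -[X in size _ <= X]sum_pE leq_size_sumn //.
rewrite -map_comp (_ : map _ _ = val p) ?valK // -[RHS]map_id.
apply/eq_in_map => i /leq_mem_sumn le_i /=.
by rewrite inordK // ltnS -sum_pE.
Qed.

HB.instance Definition _ (n : int) :=
  isFinite.Build (intpart n) (pcan_enumP (@intpart_codeK n)).

(* [schur_gap a b] is the condition on consecutive parts a >= b. *)
Definition schur_gap (a b : nat) : bool :=
  (b + 3 <= a) && ~~ [&& a == b + 3, 3 %| a & 3 %| b].

Definition schur (s : seq nat) : bool := sorted schur_gap s.

Definition mstat (s : seq nat) : nat := size s + count (fun i => ~~ odd i) s.

Definition Dset (m : nat) (n : int) : {set intpart n} :=
  [set p : intpart n | schur p & mstat p == m].

Definition Dstar (m : nat) (n : int) : {set intpart n} :=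
  [set p in Dset m n | all (fun i => if odd i then 3 <= i else 6 <= i) p].

Definition Cset (m : nat) (n : int) : {set intpart n} :=
  [set p : intpart n | [&& size p == m, all odd p
                         & all (fun i => count_mem i p <= 2) p]].

Definition Cstar (m : nat) (n : int) : {set intpart n} :=
  [set p in Cset m n | all (fun i => 1 < i) p].

(* Main.v *)
(** Weight a partition by t^m(pi) q^n, and let d_N(t) be the generating function
    of the Schur partitions with parts at most N and d*_N(t) that of those without
    the parts 1, 2 and 4.  Both satisfy the recurrence given by the largest part,
    which yields d_N(t) = (1 + tq + t^2q^2) d*_N(t) for N >= 2, N <> 3.  The same recurrence
    yields the finite functional equation
      d_{6n+2}(t) = (1 + tq + t^2q^2) d_{6n-1}(tq^2),
    proved together with a companion identity for d_{6n+5}.  Hence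
    d*_{6n+2}(t) = d_{6n-1}(tq^2), and iterating the functional equation shows that
    d_{6n-1}(t) is congruent modulo q^{6n} to the product of the factors
    1 + tq^k + t^2q^{2k} over odd k < 6n, which counts the partitions into odd
    parts occurring at most twice. *)
Require Import Defs.
From mathcomp Require Import all_boot all_order all_algebra.
From mathcomp Require Import ring zify.

Set Implicit Arguments.
Unset Strict Implicit.
Unset Printing Implicit Defensive.

Import GRing.Theory Num.Theory.

(** * Enumeration of partitions with bounded parts, each occurring at most twice *)

(** Schur partitions and the members of [Cset] all have multiplicities at most 2, so one explicit
    list serves both sides. *)
Fixpoint twice_parts (N : nat) : seq (seq nat) :=
  if N is N'.+1 then
    twice_parts N' ++ map (cons N) (twice_parts N')
                   ++ map (cons N \o cons N) (twice_parts N')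
  else [:: [::]].

Lemma mem_twice_parts (N : nat) (s : seq nat) :
  (s \in twice_parts N) =
  [&& sorted geq s, all (fun i => 0 < i <= N) s
    & all (fun i => count_mem i s <= 2) s].
Proof.
elim: N s => [|N IHN] s /=.
  by case: s => [|a s] //=; rewrite inE; apply/esym/negP => /and3P[_]; lia.
have geq_trans : transitive geq by move=> a b c /= h1 h2; apply: leq_trans h1.
have bnd (r : seq nat) : all (fun i => 0 < i <= N) r -> all (fun i => 0 < i <= N.+1) r.
  by apply: sub_all => i; lia.
have nin (r : seq nat) : all (fun i => 0 < i <= N) r -> count_mem N.+1 r = 0.
  move=> /allP h; apply/count_memPn/negP => /h; lia.
rewrite !mem_cat; apply/idP/idP.
  case/or3P.
  - by rewrite IHN => /and3P[-> /bnd -> ->].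
  - case/mapP => r; rewrite IHN => /and3P[srt b c] ->.
    rewrite /= ltnSn eqxx bnd // (nin _ b) /= path_sortedE // srt.
    have b2 : all (geq N.+1) r by apply: sub_all b => i /=; lia.
    rewrite b2 /=; apply/allP => i ir; have /andP[_ ib] := allP b i ir.
    by rewrite (_ : (N.+1 == i) = false) ?(allP c) //; apply/negbTE; lia.
  - case/mapP => r; rewrite IHN => /and3P[srt b c] ->.
    rewrite /= !ltnSn !eqxx bnd // (nin _ b) /= path_sortedE // srt.
    have b2 : all (geq N.+1) r by apply: sub_all b => i /=; lia.
    rewrite b2 /=; apply/allP => i ir; have /andP[_ ib] := allP b i ir.
    by rewrite (_ : (N.+1 == i) = false) ?(allP c) //; apply/negbTE; lia.
have low (r : seq nat) : all (fun i => 0 < i <= N.+1) r -> N.+1 \notin r ->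
    all (fun i => 0 < i <= N) r.
  move=> /allP b nr; apply/allP => i ir; have := b i ir.
  by case: (i =P N.+1) => [ei|]; [rewrite -ei ir in nr|lia].
have cnt (r r' : seq nat) : (forall i, i \in r' -> count_mem i r' <= count_mem i r) ->
    {subset r' <= r} -> all (fun i => count_mem i r <= 2) r ->
    all (fun i => count_mem i r' <= 2) r'.
  move=> h sub /allP c; apply/allP => i ir.
  exact: leq_trans (h i ir) (c i (sub i ir)).
case/and3P => srt b c.
case: s srt b c => [|a s] srt b c; first by rewrite IHN.
(* As the sequence is weakly decreasing and [N.+1] occurs at most twice, the first two entries
   decide which block contains it. *)
have [ea|na] := eqVneq a N.+1; last first.
  apply/orP; left; rewrite IHN srt c andbT; apply: low => //.
  rewrite inE eq_sym (negbTE na) /=; apply/negP => ns.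
  move: srt; rewrite /= path_sortedE // => /andP[/allP/(_ _ ns) /= h _].
  by move: b => /= /andP[]; lia.
rewrite {a}ea in srt b c *.
have srt' : sorted geq s by move: srt; exact: path_sorted.
have b' : all (fun i => 0 < i <= N.+1) s by case/andP: b.
case: s srt b c srt' b' => [|e s] srt b c srt' b'.
  by apply/or3P/Or32/map_f; rewrite IHN.
have [ee|ne] := eqVneq e N.+1.
  rewrite {e}ee in srt b c srt' b' *.
  apply/or3P/Or33; apply/mapP; exists s => //; rewrite IHN; apply/and3P; split.
  - by move: srt'; exact: path_sorted.
  - apply: low; first by case/andP: b'.
    by case/andP: c => + _; rewrite /= eqxx add1n add1n !ltnS leqn0 => /eqP/count_memPn.
  - apply: cnt c => [i _|i ii] /=; first by lia.
    by rewrite !inE ii !orbT.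
apply/or3P/Or32/map_f; rewrite IHN srt' /=; apply/andP; split.
  apply: (low (e :: s)) => //; rewrite inE eq_sym (negbTE ne) /=; apply/negP => ns.
  move: srt'; rewrite /= path_sortedE // => /andP[/allP/(_ _ ns) /= h _].
  by move: b' => /= /andP[]; lia.
apply: (cnt _ (e :: s)) c => [i _|i ii]; first by rewrite /=; lia.
by rewrite inE ii orbT.
Qed.

Lemma twice_parts_uniq (N : nat) : uniq (twice_parts N).
Proof.
elim: N => //= N IHN; rewrite !cat_uniq !map_inj_uniq ?IHN /=; first last.
- by move=> ? ? [].
- by move=> ? ? [].
have nin (s : seq nat) : N.+1 :: s \notin twice_parts N.
  by rewrite mem_twice_parts /= ltnn !andbF.
rewrite has_cat negb_or andbT -andbA; apply/and3P; split.
- by apply/hasPn => s /mapP[r _ ->].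
- by apply/hasPn => s /mapP[r _ ->]; exact: nin.
- apply/hasPn => s /mapP[r _ ->] /=; apply/mapP => -[r' /[swap] -[<-]].
  by rewrite (negbTE (nin r)).
Qed.

(** * Weighted generating functions and the recurrence on the largest part *)

Section Weights.
Local Open Scope ring_scope.
Variable R : comNzRingType.
Implicit Types (t q : R) (Q : pred (seq nat)) (N : nat).

Definition pweight t q (s : seq nat) : R := t ^+ mstat s * q ^+ sumn s.

Definition part_weight t q (a : nat) : R := t ^+ (if odd a then 1 else 2) * q ^+ a.

Definition part_gf Q t q N : R := \sum_(s <- twice_parts N | Q s) pweight t q s.

Lemma pweight_cons t q a s : pweight t q (a :: s) = part_weight t q a * pweight t q s.
Proof.
rewrite /pweight /part_weight /mstat /= mulrACA -!exprD; congr (t ^+ _ * _).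
by case: (odd a) => /=; lia.
Qed.

Lemma part_gf0 Q t q : Q [::] -> part_gf Q t q 0 = 1.
Proof. by move=> Q0; rewrite /part_gf big_mkcond big_seq1 Q0 /pweight !expr0 mulr1. Qed.

Lemma part_gfS Q t q N :
  part_gf Q t q N.+1 = part_gf Q t q N
  + part_weight t q N.+1 * part_gf (fun s => Q (N.+1 :: s)) t q N
  + part_weight t q N.+1 ^+ 2 * part_gf (fun s => Q [:: N.+1, N.+1 & s]) t q N.
Proof.
rewrite /part_gf /= !big_cat /= !big_map /= addrA !mulr_sumr.
congr (_ + _ + _); apply: eq_bigr => s _; rewrite !pweight_cons //.
by rewrite mulrA.
Qed.

Lemma eq_part_gf Q1 Q2 t q N :
  {in twice_parts N, Q1 =1 Q2} -> part_gf Q1 t q N = part_gf Q2 t q N.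
Proof. by move=> eqQ; rewrite /part_gf big_seq_cond [RHS]big_seq_cond;
  apply: eq_bigl => s; case: (boolP (s \in _)) => // /eqQ ->. Qed.

Lemma part_gf_pred0 t q N : part_gf xpred0 t q N = 0.
Proof. exact: big_pred0_eq. Qed.

Lemma part_gf_bound Q t q M N : (M <= N)%N ->
  part_gf (fun s => Q s && all (geq M) s) t q N = part_gf Q t q M.
Proof.
elim: N => [|N IHN].
  rewrite leqn0 => /eqP ->; apply: eq_part_gf => s.
  by rewrite mem_seq1 => /eqP ->; rewrite andbT.
rewrite leq_eqVlt => /orP[/eqP ->|leMN].
  apply: eq_part_gf => s; rewrite mem_twice_parts => /and3P[_ b _].
  by rewrite (_ : all _ s) ?andbT //; apply: sub_all b => i /andP[].
have vanish (f : seq nat -> seq nat) :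
    part_gf (fun s => Q (N.+1 :: f s) && all (geq M) (N.+1 :: f s)) t q N = 0.
  rewrite -[RHS](part_gf_pred0 t q N); apply: eq_part_gf => s _ /=.
  by rewrite (ltn_geF leMN) andbF.
by rewrite part_gfS IHN // (vanish id) (vanish (cons N.+1)) !mulr0 !addr0.
Qed.

(** A gap of exactly 3 is forbidden precisely when 3 divides [a], since it then divides [b] too. The
    gap condition is thus a mere upper bound on [b], which makes a recurrence in the bound [N] alone
    possible. *)
Lemma schur_gapE (a b : nat) : (0 < b)%N ->
  schur_gap a b = (b <= a - (3 + (3 %| a)))%N.
Proof.
rewrite /schur_gap => b_gt0; case: (boolP (3 %| a)%N) => d3 /=; last by lia.
have [ea|] := eqVneq a (b + 3)%N; last by lia.
have -> : (3 %| b)%N by move: d3; rewrite ea dvdn_addl.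
lia.
Qed.

Definition schur_gf (P : pred nat) t q N : R :=
  part_gf (fun s => schur s && all P s) t q N.

Lemma schur_gf0 P t q : schur_gf P t q 0 = 1.
Proof. exact: part_gf0. Qed.

Lemma schur_gfS P t q N :
  schur_gf P t q N.+1 = schur_gf P t q N
  + (P N.+1)%:R * part_weight t q N.+1
    * schur_gf P t q (N.+1 - (3 + (3 %| N.+1))).
Proof.
rewrite /schur_gf part_gfS [X in _ + X](_ : _ = 0) ?addr0; last first.
  rewrite (@eq_part_gf _ xpred0) ?part_gf_pred0 ?mulr0 // => s _ /=.
  by rewrite /schur /= (_ : schur_gap N.+1 N.+1 = false) // /schur_gap; lia.
congr (_ + _); rewrite -mulrA mulrCA; congr (_ * _).
have gap_trans : transitive (fun a b => b + 3 <= a)%N by move=> a b c; lia.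
rewrite (@eq_part_gf _ (fun s => P N.+1 && ((schur s && all P s)
    && all (geq (N.+1 - (3 + (3 %| N.+1)))%N) s))); last first.
  move=> s; rewrite mem_twice_parts => /and3P[_ pos _].
  rewrite [LHS]/= [P _ && _]andbC andbA [RHS]andbC; congr (_ && _).
  rewrite [RHS]andbAC; congr (_ && _).
  case: s pos => // b s; move: (_ - _)%N (schur_gapE N.+1) => M gapE.
  move=> /= /andP[/andP[b_gt0 _] _]; rewrite gapE // andbC [RHS]andbA -andbA.
  case: (boolP (path _ b s)) => //= gap_s; case: leqP => //= leM.
  (* The parts decrease, so bounding the head [b] bounds them all. *)
  apply/esym; have: path (fun a b => b + 3 <= a)%N b s.
    by apply: sub_path gap_s => x y /andP[].
  rewrite (path_sortedE gap_trans) => /andP[h _]; apply: sub_all h => i /=; lia.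
case: (P N.+1) => /=; last by rewrite part_gf_pred0 mul0r.
by rewrite mul1r part_gf_bound //; lia.
Qed.

Lemma part_gf_allS (P : pred nat) t q N :
  part_gf (all P) t q N.+1 =
  (1 + (P N.+1)%:R * (part_weight t q N.+1 + part_weight t q N.+1 ^+ 2))
  * part_gf (all P) t q N.
Proof.
rewrite part_gfS /=; case: (P N.+1) => /=.
  by rewrite mul1r !mulrDl mul1r addrA.
by rewrite !part_gf_pred0 !mul0r addr0 mul1r !mulr0 !addr0.
Qed.

End Weights.

(** * The finite functional equation *)

Section FunctionalEquation.
Local Open Scope ring_scope.
Variables (R : comNzRingType) (q : R).
Implicit Types (t : R) (n N : nat).

Local Notation d := (schur_gf predT).

Lemma schur_gf_rec t N M : (N.+1 - (3 + (3 %| N.+1)) = M)%N ->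
  d t q N.+1 = d t q N + part_weight t q N.+1 * d t q M.
Proof. by rewrite schur_gfS => ->; rewrite mul1r. Qed.

(** Four steps of the recurrence, with the indices not congruent to 2 modulo 3 eliminated. Weights
    depend on parity and gaps on divisibility by 3, hence the period 6 and a second relation,
    [schur_gf_rec_6n8]. *)
Lemma schur_gf_rec_6n5 t n (u := q ^+ (6 * n)) :
  d t q (6 * n).+4.+1 =
    (1 + t ^+ 2 * u * q ^+ 4 + t * u * q ^+ 5) * d t q (6 * n).+2
    + t * u * q ^+ 3 * (1 - t ^+ 3 * u * q ^+ 3) * d t q (6 * n).-1.
Proof.
rewrite (@schur_gf_rec t (6 * n).+4 (6 * n).+2); last by lia.
rewrite (@schur_gf_rec t (6 * n).+3 (6 * n).+1); last by lia.
rewrite (@schur_gf_rec t (6 * n).+2 (6 * n).-1); last by lia.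
rewrite (@schur_gf_rec t (6 * n).+1 (6 * n).-1); last by lia.
rewrite /part_weight -/u /= !oddM /= !exprS -/u; ring.
Qed.

Lemma schur_gf_rec_6n8 t n (u := q ^+ (6 * n)) :
  d t q (6 * n.+1).+2 =
    (1 + t * u * q ^+ 7 + t ^+ 2 * u * q ^+ 8) * d t q (6 * n).+4.+1
    + t ^+ 2 * u * q ^+ 6 * (1 - u * q ^+ 6) * d t q (6 * n).+2.
Proof.
have -> : (6 * n.+1 = (6 * n).+4.+2)%N by lia.
rewrite (@schur_gf_rec t (6 * n).+4.+3 (6 * n).+4.+1); last by lia.
rewrite (@schur_gf_rec t (6 * n).+4.+2 (6 * n).+4); last by lia.
rewrite (@schur_gf_rec t (6 * n).+4.+1 (6 * n).+2); last by lia.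
rewrite (@schur_gf_rec t (6 * n).+4 (6 * n).+2); last by lia.
rewrite /part_weight -/u /= !oddM /= !exprS -/u; ring.
Qed.

(* The index (6 * n).-1 is 0 instead of -1 when n = 0; this is harmless because
   the empty partition is the only one in both cases.  The second identity is
   what makes the induction close. *)
Lemma schur_gf_dilate t n :
  d t q (6 * n).+2 = (1 + t * q + t ^+ 2 * q ^+ 2) * d (t * q ^+ 2) q (6 * n).-1
  /\ d t q (6 * n).+4.+1 = (1 + t * q + t ^+ 2 * q ^+ 2)
      * (d (t * q ^+ 2) q (6 * n).+2
         + t * q ^+ (6 * n) * q ^+ 5 * (1 - t * q) * d (t * q ^+ 2) q (6 * n).-1).
Proof.
have d2 s : d s q 2 = 1 + s * q + s ^+ 2 * q ^+ 2.
  by rewrite (@schur_gf_rec s 1 0) // (@schur_gf_rec s 0 0) // !schur_gf0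
             /part_weight /=; ring.
elim: n => [|n [IHx IHy]].
  have := schur_gf_rec_6n5 t 0; rewrite muln0 /= expr0 !d2 !schur_gf0 => d5.
  by split; [ring | rewrite d5; ring].
(* In both halves, the recurrences at t and at tq^2 reduce everything to d_{6n+2}(tq^2) and
   d_{6n-1}(tq^2). *)
have Hx : d t q (6 * n.+1).+2 =
    (1 + t * q + t ^+ 2 * q ^+ 2) * d (t * q ^+ 2) q (6 * n.+1).-1.
  have -> : ((6 * n.+1).-1 = (6 * n).+4.+1)%N by lia.
  rewrite schur_gf_rec_6n8 IHy IHx schur_gf_rec_6n5; ring.
split => //; rewrite schur_gf_rec_6n5 Hx.
have -> : ((6 * n.+1).-1 = (6 * n).+4.+1)%N by lia.
have -> : q ^+ (6 * n.+1) = q ^+ (6 * n) * q ^+ 6 by rewrite -exprD; congr (_ ^+ _); lia.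
rewrite IHy schur_gf_rec_6n8 schur_gf_rec_6n5; ring.
Qed.

Definition star_part (i : nat) : bool := if odd i then (3 <= i)%N else (6 <= i)%N.

(** From part 5 on the two recurrences agree, and the factor propagates by linearity. At N = 4, the
    partitions 4 and 4+1 supply the weights of the forbidden 3+1 and 3+2, which are missing at N =
    3. *)
Lemma schur_gf_star t N : (1 < N)%N -> N != 3 ->
  d t q N = (1 + t * q + t ^+ 2 * q ^+ 2) * schur_gf star_part t q N.
Proof.
elim/ltn_ind: N => N IHN N_gt1 Nn3.
have base M : (N = M -> (1 < M < 5)%N -> M != 3 -> d t q M =
    (1 + t * q + t ^+ 2 * q ^+ 2) * schur_gf star_part t q M).
  move=> _; case: M => [|[|[|[|[|M]]]]] // _ _;
  by rewrite !schur_gfS !schur_gf0 /part_weight /star_part /=; ring.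
have [N_lt5|N_ge5] := ltnP N 5; first by apply: base; rewrite ?N_gt1.
have [e5|n5] := eqVneq N 5.
  rewrite e5 (@schur_gf_rec t 4 2) // !IHN ?e5 //.
  by rewrite [in RHS]schur_gfS /part_weight /star_part /=; ring.
case: N IHN N_gt1 Nn3 base N_ge5 n5 => // N IHN _ _ _ N_ge5 n5.
rewrite (@schur_gf_rec t N _ erefl) [in RHS]schur_gfS.
have -> : star_part N.+1 by rewrite /star_part; case: ifP; lia.
(* The smaller index is 2 when [N.+1] is 6 and at least 4 beyond, so it is never 3. *)
rewrite (IHN N) ?(IHN (N.+1 - _)%N); try lia.
by rewrite mul1r mulrDr; congr (_ + _); ring.
Qed.

End FunctionalEquation.

(** * Congruences modulo powers of q, with explicit cofactors *)

Section Truncation.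
Local Open Scope ring_scope.
Variables (R : comNzRingType) (q : R).
Implicit Types (t : R) (n N : nat).

Local Notation d := (schur_gf predT).

Lemma schur_gf_truncate t M k :
  exists r, d t q (M + k) = d t q M + q ^+ M.+1 * r.
Proof.
elim: k => [|k [r IHk]]; first by exists 0; rewrite addn0 mulr0 addr0.
rewrite addnS (schur_gf_rec q t erefl) IHk /part_weight -addSn exprD.
set e := t ^+ _; set z := d t q (_ - _).
by exists (r + e * q ^+ k * z); ring.
Qed.

Lemma schur_gf_const t N : exists r, d t q N = 1 + t * r.
Proof.
elim: N => [|N [r IHN]]; first by exists 0; rewrite schur_gf0 mulr0 addr0.
rewrite (schur_gf_rec q t erefl) IHN /part_weight.
have -> : t ^+ (if odd N.+1 then 1 else 2) = t * t ^+ (~~ odd N.+1).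
  by case: (odd _); rewrite ?expr0 ?mulr1 ?expr1 ?expr2.
set e := t ^+ (~~ _); set z := d t q (_ - _).
by exists (r + e * q ^+ N.+1 * z); ring.
Qed.

(** With u = tq^(2j), the part 2j+1 has weight uq, so the new factor is that of the functional
    equation at u. *)
Lemma part_gf_oddSS t j :
  part_gf (all odd) t q (2 * j.+1) =
  (1 + t * q ^+ (2 * j) * q + (t * q ^+ (2 * j)) ^+ 2 * q ^+ 2)
  * part_gf (all odd) t q (2 * j).
Proof.
rewrite mulnS !part_gf_allS /part_weight /= oddM /= !(exprS q); ring.
Qed.

(** An odd part counts once in [mstat], so replacing t by tq^2 adds 2 to every part. *)
Lemma part_gf_odd_dilate t j :
  part_gf (all (fun i => odd i && (1 < i)%N)) t q (2 * j.+1) =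
  part_gf (all odd) (t * q ^+ 2) q (2 * j).
Proof.
elim: j => [|j IHj].
  by rewrite !part_gf_allS !part_gf0 //=; ring.
rewrite part_gf_oddSS -IHj (mulnS 2 j.+1).
have odd_k : odd (2 * j.+1) = false by rewrite oddM.
have q_k : q ^+ (2 * j.+1) = q ^+ 2 * q ^+ (2 * j) by rewrite -exprD mulnS.
have k_gt1 : (1 < (2 * j.+1).+1)%N by [].
move: (2 * j.+1)%N k_gt1 odd_k q_k => k k_gt1 odd_k q_k.
rewrite (part_gf_allS _ _ _ k.+1) part_gf_allS /part_weight /=.
by rewrite odd_k k_gt1 /= !(exprS q) q_k; ring.
Qed.

(** In each round, d_{6n+5}(u) is congruent to d_{6n+8}(u) modulo q^(6n+6), and the functional
    equation turns the latter into a factor times d_{6n+5}(uq^2). *)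
Lemma schur_gf_odd_iter t n j :
  exists r, d t q (6 * n.+1).-1 =
    part_gf (all odd) t q (2 * j) * d (t * q ^+ (2 * j)) q (6 * n.+1).-1
    + q ^+ (6 * n.+1) * r.
Proof.
elim: j => [|j [r IHj]].
  by exists 0; rewrite muln0 part_gf0 // expr0 mulr1 mul1r mulr0 addr0.
set u := t * q ^+ (2 * j) in IHj *.
have [r' Hr'] := schur_gf_truncate u (6 * n.+1).-1 3.
have e1 : ((6 * n.+1).-1 + 3 = (6 * n.+1).+2)%N by lia.
have e2 : ((6 * n.+1).-1.+1 = 6 * n.+1)%N by lia.
rewrite e1 e2 in Hr'; have [Hx _] := schur_gf_dilate q u n.+1.
have eu : t * q ^+ (2 * j.+1) = u * q ^+ 2.
  by rewrite /u -mulrA -exprD; congr (_ * _ ^+ _); lia.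
exists (r - part_gf (all odd) t q (2 * j) * r').
rewrite IHj eu part_gf_oddSS -/u (_ : d u q _ =
  (1 + u * q + u ^+ 2 * q ^+ 2) * d (u * q ^+ 2) q (6 * n.+1).-1
  - q ^+ (6 * n.+1) * r'); first by ring.
by rewrite -Hx Hr' addrK.
Qed.

Lemma schur_gf_odd t n :
  exists r, d t q (6 * n.+1).-1 =
    part_gf (all odd) t q (2 * (3 * n.+1)) + q ^+ (6 * n.+1) * r.
Proof.
(* After 3(n+1) rounds the argument of d is tq^(6n+6), so by [schur_gf_const] the leftover factor is
   congruent to 1. *)
have [r ->] := schur_gf_odd_iter t n (3 * n.+1).
have [r' ->] := schur_gf_const (t * q ^+ (2 * (3 * n.+1))) (6 * n.+1).-1.
have -> : (2 * (3 * n.+1) = 6 * n.+1)%N by lia.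
exists (r + part_gf (all odd) t q (6 * n.+1) * t * r'); ring.
Qed.

End Truncation.

(** * Comparing coefficients of t^m q^n *)

Section Coefficients.
Local Open Scope ring_scope.

(** The outer indeterminate plays t and the inner one q. *)
Let q : {poly {poly int}} := ('X)%:P.

Lemma coef_part_gf Q c N m n :
  (part_gf Q ('X * q ^+ c) q N)`_m`_n =
  (count (fun s => [&& Q s, mstat s == m & sumn s + c * mstat s == n]%N)
     (twice_parts N))%:R.
Proof.
rewrite /part_gf !coef_sum -sum1_count natr_sum big_mkcond [RHS]big_mkcond.
apply: eq_bigr => s _; case: (Q s) => //=.
have -> : pweight ('X * q ^+ c) q s = ('X^(sumn s + c * mstat s))%:P * 'X^(mstat s).
  by rewrite polyC_exp -/q /pweight exprMn exprD exprM; ring.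
rewrite coefCM coefXn mulr_natr coefMn coefXn [(m == _)%N]eq_sym [(n == _)%N]eq_sym.
by case: (mstat s == m); case: (_ == n).
Qed.

Lemma coef_truncate (p r : {poly {poly int}}) M m n : (n < M)%N ->
  (p + q ^+ M * r)`_m`_n = p`_m`_n.
Proof.
by move=> lt_nM; rewrite !coefD /q -polyC_exp coefCM coefXnM lt_nM addr0.
Qed.

Lemma schur_gf_star_dilate n :
  schur_gf star_part 'X q (6 * n).+2 = schur_gf predT ('X * q ^+ 2) q (6 * n).-1.
Proof.
have [+ _] := schur_gf_dilate q 'X n; rewrite schur_gf_star; try lia.
(* The common factor has constant coefficient 1, so it is nonzero and cancels. *)
apply: mulfI; apply/eqP => /(congr1 (fun p : {poly {poly int}} => p`_0`_0)).
by rewrite !coefD coefXM coefXnM !coef1 !coef0.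
Qed.

(** Here [n] is both the truncation level and the degree in q: the congruence modulo q^(6n+6)
    preserves the coefficient of q^n. *)
Lemma coef_schur_gf_odd t m n :
  (schur_gf predT t q (6 * n.+1).-1)`_m`_n =
  (part_gf (all odd) t q (2 * (3 * n.+1)))`_m`_n.
Proof. by have [r ->] := schur_gf_odd q t n; rewrite coef_truncate //; lia. Qed.

Lemma count_star_dilate m n :
  count (fun s => [&& schur s && all star_part s, mstat s == m & sumn s == n])
    (twice_parts (6 * n.+1).+2) =
  count (fun s => [&& schur s, mstat s == m & (sumn s + 2 * mstat s == n)%N])
    (twice_parts (6 * n.+1).-1).
Proof.
have := coef_part_gf (fun s => schur s && all star_part s) 0 (6 * n.+1).+2 m n.
have := coef_part_gf (fun s => schur s && all predT s) 2 (6 * n.+1).-1 m n.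
rewrite expr0 mulr1 -/(schur_gf _ _ _ _) -/(schur_gf _ _ _ _).
rewrite schur_gf_star_dilate => -> /eqP; rewrite eqr_nat => /eqP E.
transitivity (count (fun s => [&& schur s && all star_part s, mstat s == m
    & (sumn s + 0 * mstat s == n)%N]) (twice_parts (6 * n.+1).+2)).
  by apply: eq_count => s; rewrite mul0n addn0.
by rewrite -E; apply: eq_count => s; rewrite all_predT andbT.
Qed.

Lemma count_star_odd m n :
  count (fun s => [&& schur s && all star_part s, mstat s == m & sumn s == n])
    (twice_parts (6 * n.+1).+2) =
  count (fun s => [&& all (fun i => odd i && (1 < i)%N) s, mstat s == m & sumn s == n])
    (twice_parts (2 * (3 * n.+1).+1)).
Proof.
have := coef_part_gf (fun s => schur s && all star_part s) 0 (6 * n.+1).+2 m n.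
have := coef_part_gf (all (fun i => odd i && (1 < i)%N)) 0 (2 * (3 * n.+1).+1) m n.
rewrite expr0 mulr1 -/(schur_gf _ _ _ _) part_gf_odd_dilate -coef_schur_gf_odd.
rewrite schur_gf_star_dilate => -> /eqP; rewrite eqr_nat => /eqP E.
under eq_count => s do rewrite -[sumn s]addn0 -(mul0n (mstat s)).
rewrite -E; apply: eq_count => s; by rewrite mul0n addn0.
Qed.

End Coefficients.

(** * From coefficient counts back to sets of partitions *)

(** No part of a partition of [n] exceeds [n], so the list misses none; for negative [n] both sides
    are 0. *)
Lemma card_intpart (n : int) (Q : pred (seq nat)) (N : nat) :
  (forall s, Q s -> sorted geq s -> all (fun i => count_mem i s <= 2) s) ->
  (n <= Posz N)%R ->
  #|[set p : intpart n | Q p]| =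
  count (fun s => Q s && (Posz (sumn s) == n)) (twice_parts N).
Proof.
move=> Q2 le_nN; rewrite cardE -size_filter -(size_map val); apply/perm_size.
apply: uniq_perm.
- by rewrite (map_inj_uniq val_inj) enum_uniq.
- exact/filter_uniq/twice_parts_uniq.
move=> s; rewrite mem_filter mem_twice_parts; apply/mapP/idP => [[p + ->]|].
  rewrite mem_enum inE => Qp; have /and3P[srt pos sum_p] := valP p.
  rewrite Qp sum_p srt (Q2 _ Qp srt) !andbT /=; apply/allP => i ip.
  rewrite (allP pos i ip) /=; apply: leq_trans (leq_mem_sumn ip) _.
  by rewrite -lez_nat (eqP sum_p).
case/andP => /andP[Qs sum_s] /and3P[srt pos _].
have is_s : is_intpart n s.
  by rewrite /is_intpart srt sum_s andbT /=; apply: sub_all pos => i /andP[].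
by exists (IntPart is_s); rewrite ?mem_enum ?inE.
Qed.

Lemma schur_count_le2 (s : seq nat) : schur s -> all (fun i => count_mem i s <= 2) s.
Proof.
move=> schur_s; apply/allP => i _; rewrite count_uniq_mem; first by case: (_ \in _).
apply: (@sorted_uniq _ (fun a b => b < a)).
- by move=> a b c h1 h2; apply: ltn_trans h1.
- by move=> a; rewrite ltnn.
by apply: sub_sorted schur_s => a b /andP[]; lia.
Qed.

Lemma mstat_odd (s : seq nat) : all odd s -> mstat s = size s.
Proof.
rewrite /mstat => /allP odd_s; rewrite (@eq_in_count _ _ pred0) ?count_pred0 ?addn0 //.
by move=> i /odd_s /= ->.
Qed.

Theorem theorem1 (m n : nat) :
  #|Dstar m (Posz n)| = #|Cstar m (Posz n)| /\
  #|Dstar m (Posz n)| = #|Dset m (Posz n - Posz (2 * m))%R|.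
Proof.
have -> : #|Dstar m (Posz n)| =
    count (fun s => [&& schur s && all star_part s, mstat s == m & sumn s == n])
      (twice_parts (6 * n.+1).+2).
  transitivity #|[set p : intpart n | [&& schur p, mstat p == m & all star_part p]]|.
    by apply: eq_card => p; rewrite !inE andbA.
  rewrite (@card_intpart _ (fun s => [&& schur s, mstat s == m & all star_part s])
             (6 * n.+1).+2).
  - by apply: eq_count => s; rewrite eqz_nat -!andbA; do !bool_congr.
  - by move=> s /andP[/schur_count_le2].
  - by rewrite lez_nat; lia.
split.
  rewrite count_star_odd.
  transitivity #|[set p : intpart n | [&& size p == m, all odd p,
      all (fun i => count_mem i p <= 2) p & all (fun i => 1 < i) p]]|; last first.
    by apply: eq_card => p; rewrite !inE -!andbA.
  rewrite (@card_intpart _ (fun s => [&& size s == m, all odd s,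
      all (fun i => count_mem i s <= 2) s & all (fun i => 1 < i) s])
      (2 * (3 * n.+1).+1)).
  - apply: eq_in_count => s; rewrite mem_twice_parts => /and3P[_ _ ->] /=.
    rewrite all_predI eqz_nat; case: (boolP (all odd s)) => [/mstat_odd ->|_] /=.
      by rewrite -!andbA; do !bool_congr.
    by rewrite andbF.
  - by move=> s /and4P[].
  - by rewrite lez_nat; lia.
rewrite count_star_dilate.
rewrite /Dset (@card_intpart _ (fun s => schur s && (mstat s == m)) (6 * n.+1).-1).
- apply: eq_count => s; rewrite -andbA; congr (_ && _).
  (* The equation is over the integers, so both sides are false when 2m > n. *)
  by case: eqP => //= ->; apply/eqP/eqP; lia.
- by move=> s /andP[/schur_count_le2].
- lia.
Qed.
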